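(* Let $T^{\mathrm P}$ be the mixed Piñeiro step-line recurrence matrix of the context, with exponents $\boldsymbol\rho\in\mathbb R^p$, $\boldsymbol\sigma\in\mathbb R^q$. Then $$T^{\mathrm P}=L_1^{\mathrm P}\cdots L_p^{\mathrm P}\,U_q^{\mathrm P}\cdots U_1^{\mathrm P},$$ where each $L_k^{\mathrm P}$ is lower bidiagonal with unit main diagonal, each $U_k^{\mathrm P}$ is upper bidiagonal with unit first superdiagonal, and for all $N\in\mathbb N_0$ $$(L_k^{\mathrm P})_{N+1,N}=\frac{\Lambda_{\mathrm L,N,\iota_N}^{[k]}}{\Lambda_{\mathrm L,N+1,\iota_{N+1}}^{[k-1]}},\quad 1\le k\le p,\qquad(U_k^{\mathrm P})_{N,N}=\frac{\Lambda_{\mathrm R,N,\iota_N}^{[k-1]}}{\Lambda_{\mathrm R,N,\iota_N}^{[k]}},\quad 1\le k\le q.$$ Here $\iota_N=(N\bmod p)+1$, $\chi_N=(N\bmod q)+1$, $\boldsymbol d_N=\boldsymbol\sigma_p(N+1)$ and $\boldsymbol c_N=\boldsymbol\sigma_q(N)$ (step-line multi-indices), and $$\Lambda_{\mathrm L,N,i}^{[k]}=\frac{(\boldsymbol\rho^{[k]}+(\sigma_{\chi_N}+(\boldsymbol c_N)_{\chi_N}+1)\mathbf 1_p)_{\boldsymbol d_N}}{(\boldsymbol\sigma-(\sigma_{\chi_N}+(\boldsymbol c_N)_{\chi_N})\mathbf 1_q)_{\boldsymbol c_N}}\;\frac{(-1)^{(\boldsymbol d_N)_i-1}((\rho_i^{[k]}+(\boldsymbol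 d_N)_i)\mathbf 1_q+\boldsymbol\sigma)_{\boldsymbol c_N}}{((\boldsymbol d_N)_i-1)!\,(\boldsymbol\rho^{[k],*i}+(1-\rho_i^{[k]}-(\boldsymbol d_N)_i)\mathbf 1_{p-1})_{\boldsymbol d_N^{*i}}},$$ $$\Lambda_{\mathrm R,N,i}^{[k]}=\frac{(\boldsymbol\rho+(\sigma_{\chi_N}^{[k]}+(\boldsymbol c_N)_{\chi_N}+1)\mathbf 1_p)_{\boldsymbol d_N}}{(\boldsymbol\sigma^{[k]}-(\sigma_{\chi_N}^{[k]}+(\boldsymbol c_N)_{\chi_N})\mathbf 1_q)_{\boldsymbol c_N}}\;\frac{(-1)^{(\boldsymbol d_N)_i-1}((\rho_i+(\boldsymbol d_N)_i)\mathbf 1_q+\boldsymbol\sigma^{[k]})_{\boldsymbol c_N}}{((\boldsymbol d_N)_i-1)!\,(\boldsymbol\rho^{*i}+(1-\rho_i-(\boldsymbol d_N)_i)\mathbf 1_{p-1})_{\boldsymbol d_N^{*i}}}.$$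
   Context: Conventions. $(c)_k=c(c+1)\cdots(c+k-1)$; for vectors, $(\boldsymbol c)_{\boldsymbol\nu}=\prod_i(c_i)_{\nu_i}$; $\mathbf 1_d=(1,\dots,1)$; $\boldsymbol c^{*i}$ is $\boldsymbol c$ with its $i$-th entry deleted (and $\boldsymbol\rho^{[k],*i}=(\boldsymbol\rho^{[k]})^{*i}$). The step-line multi-index $\boldsymbol\sigma_d(N)\in\mathbb N_0^d$ (not to be confused with the exponent vector $\boldsymbol\sigma$): if $N=dm+j$, $0\le j<d$, its first $j$ entries are $m+1$ and the rest are $m$. Cyclic affine shift: $\mathscr C_d(\theta_1,\dots,\theta_d)=(\theta_2,\dots,\theta_d,\theta_1+1)$; $\boldsymbol\rho^{[k]}=\mathscr C_p^k(\boldsymbol\rho)$, $\boldsymbol\sigma^{[k]}=\mathscr C_q^k(\boldsymbol\sigma)$. Mixed Piñeiro system: $\rho_i+\sigma_j>-1$ for all $i,j$, and the matrix of measures is $[x^{\sigma_j+\rho_i}]_{1\le j\le q,\,1\le i\le p}\,dx$ on $(0,1)$. Its scalar step-line moment matrix $\mathscr M$ has entry $\int_0^1x^{u+v+\sigma_j+\rho_i}dx=\frac1{u+v+\sigma_j+\rho_i+1}$ in row $qu+j-1$ and column $pv+i-1$ ($u,v\in\mathbb N_0$). With the Gauss–Borel factorization $\mathscr M=\mathscr L^{-1}\mathscr U^{-1}$ ($\mathscr L$ lower unitriangular, $\mathscr U$ upper triangular) and the shift matrix $\Lambda$ ($\Lambda_{N,N+1}=1$, other entries $0$), the recurrence matrix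 is $T^{\mathrm P}=\mathscr L\Lambda^q\mathscr L^{-1}$; equivalently $T^{\mathrm P}_{N,M}=\int_0^1x\,\mathcal B_N\mathcal A_M\,dx$ for the biorthonormal step-line forms. All products of semi-infinite matrices are entrywise finite sums. Standing assumption (normality and nonzero pivots): all leading principal minors of the analogous moment matrices for the exponent pairs $(\boldsymbol\rho^{[k]},\boldsymbol\sigma)$, $0\le k\le p$, and $(\boldsymbol\rho,\boldsymbol\sigma^{[k]})$, $0\le k\le q$, are nonzero, and all denominators in the displayed formulas are nonzero. *)

(* Defs.v *)
From HB Require Import structures.
From mathcomp Require Import all_boot all_order all_algebra.
From mathcomp Require Import all_classical all_reals all_analysis.

Set Implicit Arguments.
Unset Strict Implicit.
Unset Printing Implicit Defensive.

Import Order.TTheory GRing.Theory Num.Theory.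

Local Open Scope classical_set_scope.
Local Open Scope ring_scope.

(* Indices are zero-based throughout: i_N = (N mod p) + 1 in {1..p} becomes
   N mod p in {0..p-1}, and the j-th row class is j - 1. *)

Definition modord (d : nat) (hd : (0 < d)%N) (N : nat) : 'I_d :=
  Ordinal (ltn_pmod N hd).

Definition stepline (d N : nat) : 'rV[nat]_d :=
  \row_(i < d) (if (i < N %% d)%N then (N %/ d).+1 else (N %/ d)%N).

Definition poch (R : realType) (c : R) (k : nat) : R :=
  \prod_(s < k) (c + s%:R).

Definition pochv (R : realType) (d : nat) (c : 'rV[R]_d) (nu : 'rV[nat]_d) : R :=
  \prod_(i < d) poch (c ord0 i) (nu ord0 i).

(* (theta_1, ..., theta_d) |-> (theta_2, ..., theta_d, theta_1 + 1);
   ordS is the successor modulo d *)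
Definition cyc (R : realType) (d : nat) (theta : 'rV[R]_d) : 'rV[R]_d :=
  \row_(i < d) (if i.+1 == d then theta ord0 (ordS i) + 1
                else theta ord0 (ordS i)).

Definition cycn (R : realType) (d k : nat) (theta : 'rV[R]_d) : 'rV[R]_d :=
  iter k (@cyc R d) theta.

Definition simatrix (R : realType) : Type := nat -> nat -> R.

(* The sum is over the (finite) support of the summand; by convention it is 0
   if that support is infinite. *)
Definition simul (R : realType) (A B : simatrix R) : simatrix R :=
  fun N M => \sum_(k \in [set: nat]) (A N k * B k M).

Definition si1 (R : realType) : simatrix R := fun N M => (N == M)%:R.

Definition sishift (R : realType) : simatrix R := fun N M => (M == N.+1)%:R.

Definition siexp (R : realType) (A : simatrix R) (k : nat) : simatrix R :=
  iter k (simul A) (@si1 R).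

(* siprod [:: A_1; ...; A_r] = A_1 * ... * A_r *)
Definition siprod (R : realType) (s : seq (simatrix R)) : simatrix R :=
  foldr (@simul R) (@si1 R) s.

Definition si_lower (R : realType) (A : simatrix R) : Prop :=
  forall N M, (N < M)%N -> A N M = 0.

Definition si_upper (R : realType) (A : simatrix R) : Prop :=
  forall N M, (M < N)%N -> A N M = 0.

Definition si_unitdiag (R : realType) (A : simatrix R) : Prop :=
  forall N, A N N = 1.

Definition si_inverse (R : realType) (A Ai : simatrix R) : Prop :=
  simul A Ai = @si1 R /\ simul Ai A = @si1 R.

Definition lower_bidiagonal (R : realType) (A : simatrix R) : Prop :=
  forall N M, M != N -> N != M.+1 -> A N M = 0.

Definition upper_bidiagonal (R : realType) (A : simatrix R) : Prop :=
  forall N M, M != N -> M != N.+1 -> A N M = 0.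

(* M = L^-1 U^-1, with Li and Ui the triangular inverses of L and U *)
Record gauss_borel (R : realType) (M L Li U Ui : simatrix R) : Prop :=
  GaussBorel {
    gb_lowerL : si_lower L;
    gb_unitL : si_unitdiag L;
    gb_lowerLi : si_lower Li;
    gb_invL : si_inverse L Li;
    gb_upperU : si_upper U;
    gb_upperUi : si_upper Ui;
    gb_invU : si_inverse U Ui;
    gb_fact : M = simul Li Ui }.

Definition leading_minor (R : realType) (M : simatrix R) (n : nat) : R :=
  \det (\matrix_(i < n, j < n) M i j).

Section Pineiro.
Variables (R : realType) (p q : nat) (hp : (0 < p)%N) (hq : (0 < q)%N).
Implicit Types (rho : 'rV[R]_p) (sigma : 'rV[R]_q).

Definition pineiro_moment rho sigma : simatrix R := fun N M =>
  \int[lebesgue_measure]_(x in `]0%R, 1%R[)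
     (x `^ ((N %/ q)%:R + (M %/ p)%:R
            + sigma ord0 (modord hq N) + rho ord0 (modord hp M)))%R.

Definition normal_pair rho sigma : Prop :=
  forall n, leading_minor (pineiro_moment rho sigma) n != 0.

Definition recurrence_matrix (L Li : simatrix R) : simatrix R :=
  simul (simul L (siexp (@sishift R) q)) Li.

(* sigma_{chi_N} + (c_N)_{chi_N} *)
Definition topexp sigma (N : nat) : R :=
  sigma ord0 (modord hq N) + (stepline q N ord0 (modord hq N))%:R.

Definition Lam_den1 sigma (N : nat) : R :=
  pochv (sigma - const_mx (topexp sigma N)) (stepline q N).

Definition Lam_den2 rho (N : nat) (i : 'I_p) : R :=
  let d := stepline p N.+1 in
  pochv (col' i rho + const_mx (1 - rho ord0 i - (d ord0 i)%:R)) (col' i d).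

(* The common shape of Lambda_L and Lambda_R. It is meaningful when
   (d_N)_i >= 1, which holds at i = iota_N; otherwise (d_N)_i - 1 is truncated
   to 0. *)
Definition Lam rho sigma (N : nat) (i : 'I_p) : R :=
  let d := stepline p N.+1 in
  let c := stepline q N in
  pochv (rho + const_mx (topexp sigma N + 1)) d / Lam_den1 sigma N *
  ((- 1) ^+ (d ord0 i).-1
     * pochv (const_mx (rho ord0 i + (d ord0 i)%:R) + sigma) c
   / (((d ord0 i).-1)`!%:R * Lam_den2 rho N i)).

Definition LamL rho sigma (k N : nat) (i : 'I_p) : R :=
  Lam (cycn k rho) sigma N i.

Definition LamR rho sigma (k N : nat) (i : 'I_p) : R :=
  Lam rho (cycn k sigma) N i.

Definition all_normal rho sigma : Prop :=
  (forall k, (k <= p)%N -> normal_pair (cycn k rho) sigma) /\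
  (forall k, (k <= q)%N -> normal_pair rho (cycn k sigma)).

Definition nonzero_denominators rho sigma : Prop :=
  [/\ forall k N, (k <= p)%N ->
        Lam_den1 sigma N != 0 /\
        Lam_den2 (cycn k rho) N (modord hp N) != 0,
      forall k N, (k <= q)%N ->
        Lam_den1 (cycn k sigma) N != 0 /\
        Lam_den2 rho N (modord hp N) != 0,
      forall k N, (1 <= k <= p)%N ->
        LamL rho sigma k.-1 N.+1 (modord hp N.+1) != 0
    & forall k N, (1 <= k <= q)%N ->
        LamR rho sigma k N (modord hp N) != 0].

End Pineiro.

(* Main.v *)
Require Import Defs.
From HB Require Import structures.
From mathcomp Require Import all_boot all_order all_algebra.
From mathcomp Require Import all_classical all_reals all_analysis.
From mathcomp Require Import measurable_realfun ring lra zify.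

Set Implicit Arguments.
Unset Strict Implicit.
Unset Printing Implicit Defensive.

Import Order.TTheory GRing.Theory Num.Theory.

Local Open Scope ring_scope.

(** Put x_N = sigma_{chi_N} + floor(N/q) and y_M = rho_{iota_M} + floor(M/p) + 1.
    The moment matrix is the Cauchy matrix 1 / (x_N + y_M), and the cyclic shifts
    of rho and sigma are index shifts of y and x.  A Cauchy matrix has an explicit
    Gauss-Borel factorization M = l u, coming from the telescoping expansion
      1/(s+t) = sum_k c_k(s) c'_k(t) (x_k + y_k) + remainder,
      c_k(s) = prod_{m<k} (s - x_m) / prod_{m<=k} (s + y_m),
    with c' obtained by exchanging x and y; the quantities Lambda are the inverse
    pivots.  Shifting y multiplies l on the right by a lower bidiagonal matrix,
    while (l for shifted x) * (upper bidiagonal) = S l, S being the shift matrix.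
    After p shifts of y, or q shifts of x, one reaches the same lower factor,
    because both shifts then amount to adding 1; hence
    S^q l = l L_1 ... L_p U_q ... U_1. *)

(** * Row-finite matrices *)

Section RowFinite.
Variable R : realType.
Implicit Types A B C : simatrix R.

Definition row_finite A := forall N, exists n, forall k, (n <= k)%N -> A N k = 0.

Lemma simulE A B N M n :
  (forall k, (n <= k)%N -> A N k * B k M = 0) ->
  simul A B N M = \sum_(k < n) A N k * B k M.
Proof.
move=> h; rewrite /simul -(fsbig_widen `I_n [set: nat]%classic)//= => [|k].
  by rewrite -fsbig_ord.
by move=> [_ /= /negP]; rewrite -leqNgt => /h.
Qed.

Lemma row_finite_bound A n : row_finite A ->
  exists m, forall N k, (N < n)%N -> (m <= k)%N -> A N k = 0.
Proof.
move=> fA; elim: n => [|n [m hm]]; first by exists 0%N.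
have [m' hm'] := fA n; exists (maxn m m') => N k.
rewrite ltnS leq_eqVlt geq_max => /orP[/eqP->|Nn] /andP[mk m'k].
  exact: hm'.
exact: hm.
Qed.

Lemma row_finite_simul A B : row_finite A -> row_finite B ->
  row_finite (simul A B).
Proof.
move=> fA fB N; have [n hn] := fA N; have [m hm] := row_finite_bound n fB.
exists m => M mM; rewrite (@simulE _ _ _ _ n) => [|k /hn->]; last by rewrite mul0r.
by apply: big1 => k _; rewrite hm ?mulr0.
Qed.

Lemma simulA A B C : row_finite A -> row_finite B ->
  simul A (simul B C) = simul (simul A B) C.
Proof.
move=> fA fB; apply/funext => N; apply/funext => M.
have [n hn] := fA N; have [m hm] := row_finite_bound n fB.
have AB0 k : simul A B N k = \sum_(i < n) A N i * B i k.
  by apply: simulE => i /hn->; rewrite mul0r.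
rewrite (@simulE _ _ _ _ n) => [|k /hn->]; last by rewrite mul0r.
rewrite (@simulE _ _ _ _ m) => [|k mk]; last first.
  by rewrite AB0 big1 ?mul0r// => i _; rewrite hm ?mulr0.
under [RHS]eq_bigr do rewrite AB0 mulr_suml.
rewrite exchange_big /=; apply: eq_bigr => i _.
rewrite (@simulE _ _ _ _ m) => [|k mk]; last by rewrite hm ?mul0r.
by rewrite mulr_sumr; apply: eq_bigr => k _; rewrite mulrA.
Qed.

Lemma si_lower_row_finite A : si_lower A -> row_finite A.
Proof. by move=> lA N; exists N.+1 => k; apply: lA. Qed.

Lemma upper_bidiagonal_row_finite A : upper_bidiagonal A -> row_finite A.
Proof. by move=> bA N; exists N.+2 => k Nk; apply: bA; lia. Qed.

Lemma simul_lower A B : si_lower A -> si_lower B -> si_lower (simul A B).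
Proof.
move=> lA lB N M NM; rewrite (@simulE _ _ _ _ N.+1) => [|k /lA->]; last by rewrite mul0r.
by apply: big1 => k _; rewrite lB ?mulr0//; have := ltn_ord k; lia.
Qed.

Lemma simul_unitdiag A B : si_lower A -> si_lower B ->
  si_unitdiag A -> si_unitdiag B -> si_unitdiag (simul A B).
Proof.
move=> lA lB dA dB N; rewrite (@simulE _ _ _ _ N.+1) => [|k /lA->]; last by rewrite mul0r.
rewrite big_ord_recr/= dA dB mul1r big1 ?add0r// => k _.
by rewrite lB ?mulr0.
Qed.

Lemma lower_bidiagonal_lower A : lower_bidiagonal A -> si_lower A.
Proof. by move=> bA N M NM; apply: bA; lia. Qed.

Lemma si1_row_finite : row_finite (@si1 R).
Proof. by move=> N; exists N.+1 => k Nk; rewrite /si1 ltn_eqF. Qed.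

Lemma si1_simul A : simul (@si1 R) A = A.
Proof.
apply/funext => N; apply/funext => M; rewrite (@simulE _ _ _ _ N.+1) => [|k Nk].
  rewrite big_ord_recr/= /si1 eqxx mul1r big1 ?add0r// => k _.
  by rewrite gtn_eqF ?mul0r.
by rewrite /si1 ltn_eqF ?mul0r.
Qed.

Lemma simul_si1 A : row_finite A -> simul A (@si1 R) = A.
Proof.
move=> fA; apply/funext => N; apply/funext => M; have [n hn] := fA N.
have [nM|Mn] := leqP n M.
  rewrite (@simulE _ _ _ _ n) => [|k /hn->]; last by rewrite mul0r.
  by rewrite hn// big1// => k _; rewrite /si1 ltn_eqF ?mulr0// (leq_trans _ nM).
rewrite (@simulE _ _ _ _ n) => [|k /hn->]; last by rewrite mul0r.
rewrite (bigD1 (Ordinal Mn))//= /si1 eqxx mulr1 big1 ?addr0// => k.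
by rewrite -val_eqE/= => /negbTE->; rewrite mulr0.
Qed.

Lemma simul_sishift A N M : simul (@sishift R) A N M = A N.+1 M.
Proof.
rewrite (@simulE _ _ _ _ N.+2) => [|k Nk]; last by rewrite /sishift gtn_eqF ?mul0r.
rewrite big_ord_recr/= /sishift eqxx mul1r big1 ?add0r// => k _.
by rewrite ltn_eqF ?mul0r.
Qed.

Lemma sishift_row_finite : row_finite (@sishift R).
Proof. by move=> N; exists N.+2 => k Nk; rewrite /sishift gtn_eqF. Qed.

Lemma siexp_shift_row_finite k : row_finite (siexp (@sishift R) k).
Proof.
elim: k => [|k IH]; first exact: si1_row_finite.
exact: row_finite_simul sishift_row_finite IH.
Qed.

Lemma row_finite_siprod (I : Type) (f : I -> simatrix R) (s : seq I) :
  (forall i, row_finite (f i)) -> row_finite (siprod [seq f i | i <- s]).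
Proof.
by move=> ff; elim: s => [|i s IH]; [exact: si1_row_finite|exact: row_finite_simul].
Qed.

Lemma simul_lower_bidiagonal A B N M : lower_bidiagonal B -> row_finite A ->
  simul A B N M = A N M * B M M + A N M.+1 * B M.+1 M.
Proof.
move=> bB fA; have [n hn] := fA N.
rewrite (@simulE _ _ _ _ (maxn n M.+2)) => [|k]; last first.
  by rewrite geq_max => /andP[/hn-> _]; rewrite mul0r.
have M0 : (M < maxn n M.+2)%N by rewrite leq_max ltnS leqnSn orbT.
have M1 : (M.+1 < maxn n M.+2)%N by rewrite leq_max leqnn orbT.
rewrite (bigD1 (Ordinal M0))//= (bigD1 (Ordinal M1))/=; last first.
  by rewrite -val_eqE/= gtn_eqF.
rewrite big1 ?addr0// => k; rewrite -!val_eqE/= => /andP[kM kM1].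
by rewrite bB ?mulr0// eq_sym.
Qed.

Lemma simul_upper_bidiagonal A B N M : upper_bidiagonal B ->
  simul A B N M = A N M * B M M +
    (if M is M'.+1 then A N M' * B M' M else 0).
Proof.
move=> bB; rewrite (@simulE _ _ _ _ M.+1) => [|k Mk]; last first.
  by rewrite bB ?mulr0//; lia.
rewrite big_ord_recr/= addrC; congr (_ + _).
case: M bB => [|M] bB; first by rewrite big_ord0.
rewrite big_ord_recr/= big1 ?add0r// => k _.
by rewrite bB ?mulr0//; have := ltn_ord k; lia.
Qed.

Lemma unit_lower_upper_eq1 W u : si_lower W -> si_unitdiag W ->
  si_upper u -> (forall N, u N N != 0) -> si_upper (simul W u) ->
  W = @si1 R.
Proof.
move=> lW dW uu u0 uWu.
suff W0 M N : (M < N)%N -> W N M = 0.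
  apply/funext => N; apply/funext => M; rewrite /si1.
  by have [/W0->|/lW->|->] := ltngtP M N; rewrite ?eqxx//; case: eqP => //; lia.
elim/ltn_ind: M N => M IH N MN; have := uWu N M MN.
rewrite (@simulE _ _ _ _ M.+1) => [|k Mk]; last by rewrite uu ?mulr0.
rewrite big_ord_recr/= big1 => [|k _]; last first.
  by rewrite IH ?mul0r// (ltn_trans _ MN).
by rewrite add0r => /eqP; rewrite mulf_eq0 (negbTE (u0 M)) orbF => /eqP.
Qed.

End RowFinite.

(** * Cauchy matrices and their bidiagonal factors *)

Section Cauchy.
Variable R : realType.
Implicit Types (x y : nat -> R) (s t : R) (N M j : nat).

Definition shiftseq (n : nat) x : nat -> R := fun m => x (m + n)%N.

Definition cauchy_basis x y j s : R :=
  (\prod_(m < j) (s - x m)) / \prod_(m < j.+1) (s + y m).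

Definition cauchy_lower x y : simatrix R :=
  fun N M => cauchy_basis x y M (x N) / cauchy_basis x y M (x M).

Definition cauchy_upper x y : simatrix R :=
  fun N M => cauchy_basis x y N (x N) * cauchy_basis y x N (y M) * (x N + y N).

Definition cauchy_pivot x y j : R := cauchy_upper x y j j.

Lemma cauchy_basis_root x y j N : (N < j)%N -> cauchy_basis x y j (x N) = 0.
Proof.
by move=> Nj; rewrite /cauchy_basis (bigD1 (Ordinal Nj))//= subrr !mul0r.
Qed.

Lemma cauchy_basisS x y j s :
  cauchy_basis x y j.+1 s = cauchy_basis x y j s * ((s - x j) / (s + y j.+1)).
Proof.
by rewrite /cauchy_basis big_ord_recr/= [X in _ / X]big_ord_recr/= invfM; ring.
Qed.

Lemma cauchy_basis_shift x y j s :
  cauchy_basis x y j.+1 s =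
  cauchy_basis (shiftseq 1 x) y j s * ((s - x 0%N) / (s + y j.+1)).
Proof.
rewrite /cauchy_basis big_ord_recl/= [X in _ / X]big_ord_recr/= invfM.
under eq_bigr do rewrite /bump leq0n add1n -addn1.
by rewrite /shiftseq; ring.
Qed.

Lemma cauchy_basis_shift_den x y j s :
  s + y 0%N != 0 ->
  cauchy_basis x (shiftseq 1 y) j s =
  cauchy_basis x y j s * ((s + y 0%N) / (s + y j.+1)).
Proof.
move=> y0; rewrite /cauchy_basis big_ord_recr/= [X in _ = _ / X * _]big_ord_recl/=.
under [X in _ = _ / (_ * X) * _]eq_bigr do rewrite /bump leq0n add1n -addn1.
by rewrite /shiftseq addn1 !invfM -!mulrA; congr (_ * _); rewrite [RHS]mulrCA mulKf.
Qed.

Definition cauchy_generic x y :=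
  [/\ forall i j, x i + y j != 0, forall i j, (i < j)%N -> x j - x i != 0
    & forall i j, (i < j)%N -> y j - y i != 0].

Lemma generic_sym x y : cauchy_generic x y -> cauchy_generic y x.
Proof. by case=> xy xx yy; split=> // i j; rewrite addrC. Qed.

Lemma generic_shiftl n x y : cauchy_generic x y -> cauchy_generic (shiftseq n x) y.
Proof.
case=> xy xx yy; split=> [i j||//]; first exact: xy.
by move=> i j ij; apply: xx; rewrite ltn_add2r.
Qed.

Lemma generic_shiftr n x y : cauchy_generic x y -> cauchy_generic x (shiftseq n y).
Proof. by move=> /generic_sym/(generic_shiftl n)/generic_sym. Qed.

Lemma shiftseq0 x : shiftseq 0 x = x.
Proof. by apply/funext => m; rewrite /shiftseq addn0. Qed.

Lemma shiftseqS n x : shiftseq 1 (shiftseq n x) = shiftseq n.+1 x.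
Proof. by apply/funext => m; rewrite /shiftseq -addnA add1n. Qed.

Lemma cauchy_basis_diag_neq0 x y j : cauchy_generic x y -> cauchy_basis x y j (x j) != 0.
Proof.
case=> xy xx _; rewrite mulf_neq0// ?invr_neq0//; apply/prodf_neq0 => m _ //.
exact: xx.
Qed.

Lemma cauchy_pivot_neq0 x y j : cauchy_generic x y -> cauchy_pivot x y j != 0.
Proof.
move=> g; apply: mulf_neq0; first apply: mulf_neq0.
- exact: cauchy_basis_diag_neq0.
- by apply/cauchy_basis_diag_neq0/generic_sym.
- by case: g.
Qed.

Lemma cauchy_lower_lower x y : si_lower (cauchy_lower x y).
Proof. by move=> N M NM; rewrite /cauchy_lower cauchy_basis_root ?mul0r. Qed.

Lemma cauchy_lower_unitdiag x y : cauchy_generic x y -> si_unitdiag (cauchy_lower x y).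
Proof. by move=> g N; rewrite /cauchy_lower divff// cauchy_basis_diag_neq0. Qed.

Lemma cauchy_upper_upper x y : si_upper (cauchy_upper x y).
Proof.
by move=> N M MN; rewrite /cauchy_upper (cauchy_basis_root _ _ MN) mulr0 mul0r.
Qed.

Lemma sum_cauchy_basis x y s t n :
  s + t != 0 -> (forall m, s + y m != 0) -> (forall m, t + x m != 0) ->
  \sum_(k < n) cauchy_basis x y k s * cauchy_basis y x k t * (x k + y k) =
  (s + t)^-1 *
    (1 - \prod_(m < n) ((s - x m) * (t - y m) / ((s + y m) * (t + x m)))).
Proof.
move=> st sy tx; elim: n => [|n IH]; first by rewrite !big_ord0 subrr mulr0.
rewrite big_ord_recr/= IH [in RHS]big_ord_recr/=.
have -> : cauchy_basis x y n s * cauchy_basis y x n t =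
    (\prod_(m < n) ((s - x m) * (t - y m) / ((s + y m) * (t + x m)))) /
    ((s + y n) * (t + x n)).
  rewrite /cauchy_basis !big_ord_recr/= prodf_div !big_split/= !invfM.
  by ring.
by field; rewrite st sy tx.
Qed.

Lemma cauchy_lower_upper x y N M : cauchy_generic x y ->
  simul (cauchy_lower x y) (cauchy_upper x y) N M = (x N + y M)^-1.
Proof.
move=> g; have [xy _ _] := g.
rewrite (@simulE _ _ _ _ _ N.+1) => [|k Nk]; last first.
  by rewrite cauchy_lower_lower ?mul0r.
transitivity (\sum_(k < N.+1) cauchy_basis x y k (x N) *
    cauchy_basis y x k (y M) * (x k + y k)).
  apply: eq_bigr => k _; rewrite /cauchy_lower /cauchy_upper.
  by have := cauchy_basis_diag_neq0 k g => b0; field.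
rewrite sum_cauchy_basis//; last by move=> m; rewrite addrC.
by rewrite big_ord_recr/= subrr !mul0r mulr0 subr0 mulr1.
Qed.

Lemma cauchy_lower_shift_right x y N j : cauchy_generic x y ->
  cauchy_lower x y N j + cauchy_lower x y N j.+1 *
    (cauchy_pivot x y j.+1 / cauchy_pivot x (shiftseq 1 y) j) =
  cauchy_lower x (shiftseq 1 y) N j.
Proof.
move=> g; have [xy xx yy] := g.
have g' : cauchy_generic x (shiftseq 1 y) by exact: generic_shiftr.
have b0 := cauchy_basis_diag_neq0 j g.
have bS0 := cauchy_basis_diag_neq0 j.+1 g.
have c0 := cauchy_basis_diag_neq0 j (generic_sym g').
rewrite /cauchy_lower /cauchy_pivot /cauchy_upper !cauchy_basis_shift_den//.
rewrite [cauchy_basis x y j.+1 (x N)]cauchy_basisS.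
rewrite [cauchy_basis y x _ _]cauchy_basis_shift.
rewrite /shiftseq addn1 in c0 *.
field.
by rewrite b0 bS0 c0 !(addrC (y _)) !xy.
Qed.

Lemma cauchy_lower_shift_left x y N j : cauchy_generic x y ->
  cauchy_lower (shiftseq 1 x) y N j *
    (cauchy_pivot (shiftseq 1 x) y j / cauchy_pivot x y j) +
  (if j is j'.+1 then cauchy_lower (shiftseq 1 x) y N j' else 0) =
  cauchy_lower x y N.+1 j.
Proof.
move=> g; have [xy xx yy] := g.
have g' : cauchy_generic (shiftseq 1 x) y by exact/generic_shiftl.
have bj := cauchy_basis_diag_neq0 j g'.
have c0 := cauchy_basis_diag_neq0 j (generic_sym g).
rewrite /cauchy_pivot /cauchy_upper cauchy_basis_shift_den; last by rewrite addrC.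
case: j bj c0 => [|j] bj c0.
  rewrite /cauchy_lower in bj c0 *; rewrite /cauchy_basis !big_ord0 !big_ord1 in bj c0 *.
  rewrite /shiftseq !addn1.
  by field; rewrite !(addrC (y _)) !xy.
have b0 := cauchy_basis_diag_neq0 j g'.
rewrite /cauchy_lower.
rewrite [cauchy_basis (shiftseq 1 x) y j.+1 (shiftseq _ _ N)]cauchy_basisS.
rewrite ![cauchy_basis x y j.+1 _]cauchy_basis_shift.
rewrite /shiftseq !addn1 in b0 bj c0 *.
field.
by rewrite b0 bj c0 !(addrC (y _)) !xy xx.
Qed.

Lemma cauchy_lower_translate x y c :
  cauchy_lower x (fun m => y m + c) = cauchy_lower (fun m => x m + c) y.
Proof.
have e j N : cauchy_basis x (fun m => y m + c) j (x N) =
    cauchy_basis (fun m => x m + c) y j (x N + c).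
  rewrite /cauchy_basis; congr (_ / _); apply: eq_bigr => m _; ring.
by apply/funext => N; apply/funext => M; rewrite /cauchy_lower !e.
Qed.

Definition cauchy_lower_factor x y : simatrix R := fun N M =>
  if M == N then 1 else
  if N == M.+1 then cauchy_pivot x y N / cauchy_pivot x (shiftseq 1 y) M else 0.

Definition cauchy_upper_factor x y : simatrix R := fun N M =>
  if M == N then cauchy_pivot (shiftseq 1 x) y N / cauchy_pivot x y N
  else (M == N.+1)%:R.

Lemma cauchy_lower_factor_bidiagonal x y :
  lower_bidiagonal (cauchy_lower_factor x y).
Proof.
by move=> N M /negbTE MN /negbTE NM; rewrite /cauchy_lower_factor MN NM.
Qed.

Lemma cauchy_upper_factor_bidiagonal x y :
  upper_bidiagonal (cauchy_upper_factor x y).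
Proof.
by move=> N M /negbTE MN /negbTE NM; rewrite /cauchy_upper_factor MN NM.
Qed.

Lemma cauchy_lower_factorP x y : cauchy_generic x y ->
  simul (cauchy_lower x y) (cauchy_lower_factor x y) =
  cauchy_lower x (shiftseq 1 y).
Proof.
move=> g; apply/funext => N; apply/funext => M.
rewrite simul_lower_bidiagonal; last 2 first.
- exact: cauchy_lower_factor_bidiagonal.
- exact/si_lower_row_finite/cauchy_lower_lower.
rewrite -(cauchy_lower_shift_right _ _ g) /cauchy_lower_factor !eqxx mulr1.
by rewrite ltn_eqF.
Qed.

Lemma cauchy_upper_factorP x y : cauchy_generic x y ->
  simul (cauchy_lower (shiftseq 1 x) y) (cauchy_upper_factor x y) =
  simul (@sishift R) (cauchy_lower x y).
Proof.
move=> g; apply/funext => N; apply/funext => M.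
rewrite simul_upper_bidiagonal; last exact: cauchy_upper_factor_bidiagonal.
rewrite simul_sishift -cauchy_lower_shift_left// /cauchy_upper_factor eqxx.
by case: M => [//|M]; rewrite gtn_eqF// eqxx mulr1.
Qed.

Lemma siprod_cauchy_lower_factor x y n m : cauchy_generic x y ->
  simul (cauchy_lower x (shiftseq m y))
    (siprod [seq cauchy_lower_factor x (shiftseq k.-1 y) | k <- iota m.+1 n]) =
  cauchy_lower x (shiftseq (m + n) y).
Proof.
move=> g; elim: n m => [|n IH] m.
  by rewrite addn0 simul_si1//; apply/si_lower_row_finite/cauchy_lower_lower.
rewrite /= simulA.
- rewrite cauchy_lower_factorP ?shiftseqS ?IH ?addSnnS//; exact: generic_shiftr.
- exact/si_lower_row_finite/cauchy_lower_lower.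
- exact/si_lower_row_finite/lower_bidiagonal_lower/cauchy_lower_factor_bidiagonal.
Qed.

Lemma siprod_cauchy_upper_factor x y n : cauchy_generic x y ->
  simul (cauchy_lower (shiftseq n x) y)
    (siprod [seq cauchy_upper_factor (shiftseq k.-1 x) y | k <- rev (iota 1 n)]) =
  simul (siexp (@sishift R) n) (cauchy_lower x y).
Proof.
have fl z : row_finite (cauchy_lower z y).
  exact/si_lower_row_finite/cauchy_lower_lower.
move=> g; elim: n => [|n IH].
  by rewrite si1_simul simul_si1// shiftseq0.
have -> : rev (iota 1 n.+1) = n.+1 :: rev (iota 1 n).
  by rewrite -[in LHS](addn1 n) iotaD rev_cat /= add1n.
rewrite /= simulA//; last first.
  exact/upper_bidiagonal_row_finite/cauchy_upper_factor_bidiagonal.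
rewrite -shiftseqS cauchy_upper_factorP; last exact: generic_shiftl.
rewrite -simulA//; last exact: sishift_row_finite.
rewrite IH simulA//; first exact: sishift_row_finite.
exact: siexp_shift_row_finite.
Qed.

Lemma cauchy_gauss_borel_unique x y (M L Li U Ui : simatrix R) : cauchy_generic x y ->
  (forall i j, M i j = (x i + y j)^-1) -> gauss_borel M L Li U Ui ->
  Li = cauchy_lower x y.
Proof.
move=> g Mxy [lL dL lLi [LLi LiL] uU uUi _ MLU].
have fL := si_lower_row_finite lL; have fLi := si_lower_row_finite lLi.
have ll := @cauchy_lower_lower x y; have fl := si_lower_row_finite ll.
suff W1 : simul L (cauchy_lower x y) = @si1 R.
  by rewrite -[LHS]simul_si1// -W1 simulA// LiL si1_simul.
apply: (@unit_lower_upper_eq1 _ _ (cauchy_upper x y)).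
- exact: simul_lower.
- by apply: simul_unitdiag => //; exact: cauchy_lower_unitdiag.
- exact: cauchy_upper_upper.
- by move=> N; exact: cauchy_pivot_neq0.
rewrite -simulA// (_ : simul (cauchy_lower x y) _ = M); last first.
  by apply/funext => i; apply/funext => j; rewrite cauchy_lower_upper.
by rewrite MLU simulA// LLi si1_simul.
Qed.

Lemma cauchy_bidiagonal_factorization p q x y (M L Li U Ui : simatrix R) :
  cauchy_generic x y -> (forall i j, M i j = (x i + y j)^-1) ->
  (forall m, x (m + q)%N = x m + 1) -> (forall m, y (m + p)%N = y m + 1) ->
  gauss_borel M L Li U Ui ->
  recurrence_matrix q L Li =
  simul (siprod [seq cauchy_lower_factor x (shiftseq k.-1 y) | k <- iota 1 p])
    (siprod [seq cauchy_upper_factor (shiftseq k.-1 x) y | k <- rev (iota 1 q)]).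
Proof.
move=> g Mxy xq yp gb; have [lL _ lLi [LLi _] _ _ _ _] := gb.
have fL := si_lower_row_finite lL; have fLi := si_lower_row_finite lLi.
have eLi := cauchy_gauss_borel_unique g Mxy gb.
have fPL := @row_finite_siprod R _ (fun k => cauchy_lower_factor x (shiftseq k.-1 y))
  (iota 1 p) (fun k => si_lower_row_finite
    (lower_bidiagonal_lower (@cauchy_lower_factor_bidiagonal x (shiftseq k.-1 y)))).
rewrite /recurrence_matrix -simulA//; last exact: siexp_shift_row_finite.
rewrite [in X in simul L X]eLi -siprod_cauchy_upper_factor//.
rewrite (_ : cauchy_lower (shiftseq q x) y = cauchy_lower x (shiftseq (0 + p) y)).
  rewrite -siprod_cauchy_lower_factor// shiftseq0 -eLi.
  by rewrite -simulA// simulA// LLi si1_simul.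
rewrite (_ : shiftseq q x = fun m => x m + 1); last exact/funext.
rewrite (_ : shiftseq (0 + p) y = fun m => y m + 1); last exact/funext.
by rewrite cauchy_lower_translate.
Qed.

End Cauchy.

(** * Step-line products and the quantities Lambda *)

Section Steplines.
Variables (R : realType) (d : nat) (hd : (0 < d)%N).
Implicit Type (theta : 'rV[R]_d).

Lemma steplineE N (i : 'I_d) :
  stepline d N ord0 i = (N %/ d + (i < N %% d))%N.
Proof. by rewrite mxE; case: ifP; rewrite ?addn1 ?addn0. Qed.

Lemma steplineS N (i : 'I_d) :
  stepline d N.+1 ord0 i = (stepline d N ord0 i + (i == modord hd N))%N.
Proof.
rewrite !steplineE -val_eqE/=; have id := ltn_ord i.
rewrite divnS// modnS.
case: ifPn => [dvd|ndvd] /=; last first.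
  by rewrite ltnS leq_eqVlt; case: (ltngtP (i : nat)) => //=; rewrite ?addn0 ?addn1.
have Nd := ltn_pmod N hd.
have : (N %% d = d.-1)%N.
  move: dvd; rewrite {1}(divn_eq N d) -addnS dvdn_addr ?dvdn_mull// => /dvdn_leq.
  by move=> /(_ isT); lia.
by move=> ->; lia.
Qed.

Lemma topexpE theta N :
  topexp hd theta N = theta ord0 (modord hd N) + (N %/ d)%:R.
Proof. by rewrite /topexp steplineE/= ltnn addn0. Qed.

Lemma stepline_prod (f : 'I_d -> nat -> R) N :
  \prod_(i < d) \prod_(s < stepline d N ord0 i) f i s =
  \prod_(M < N) f (modord hd M) (M %/ d)%N.
Proof.
elim: N => [|N IH].
  by rewrite big_ord0 big1// => i _; rewrite steplineE div0n mod0n ltn0 big_ord0.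
rewrite big_ord_recr/= -IH (bigD1 (modord hd N))//= [in RHS](bigD1 (modord hd N))//=.
rewrite steplineS eqxx addn1 big_ord_recr/=.
rewrite [X in f _ X](_ : _ = N %/ d)%N; last by rewrite steplineE/= ltnn addn0.
rewrite mulrAC; congr (_ * _ * _); apply: eq_bigr => i /negbTE iN.
by rewrite steplineS iN addn0.
Qed.

Lemma pochv_stepline theta c N :
  pochv (theta + const_mx c) (stepline d N) =
  \prod_(M < N) (topexp hd theta M + c).
Proof.
rewrite /pochv /poch.
rewrite (stepline_prod (fun i s => (theta + const_mx c) ord0 i + s%:R)).
by apply: eq_bigr => M _; rewrite topexpE !mxE addrAC.
Qed.

Lemma topexp_cyc theta N :
  topexp hd (cyc theta) N = topexp hd theta N.+1.
Proof.
rewrite !topexpE mxE/= divnS//.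
have Nd := ltn_pmod N hd.
have e : (d %| N.+1)%N = ((N %% d).+1 == d)%N.
  rewrite {1}(divn_eq N d) -addnS dvdn_addr ?dvdn_mull//.
  apply/idP/eqP => [h|->]; last exact: dvdnn.
  by apply/eqP; rewrite eqn_leq Nd dvdn_leq.
have -> : ordS (modord hd N) = modord hd N.+1.
  by apply: val_inj; rewrite /= -addn1 modnDml addn1.
rewrite e; case: eqP => _; last by rewrite add0n.
by rewrite natrD -addrA.
Qed.

Lemma topexp_cycn theta k N :
  topexp hd (cycn k theta) N = topexp hd theta (N + k)%N.
Proof.
by elim: k N => [|k IH] N; rewrite ?addn0// /cycn iterS topexp_cyc IH addSnnS.
Qed.

Lemma topexp_period theta N :
  topexp hd theta (N + d)%N = topexp hd theta N + 1.
Proof.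
rewrite !topexpE divnDr// divnn hd natrD addrA; congr (theta _ _ + _ + _).
by apply: val_inj; rewrite /= modnDr.
Qed.

End Steplines.

Section LamCauchy.
Variable R : realType.

Lemma Lam_den1E q (hq : (0 < q)%N) (sigma : 'rV[R]_q) N :
  Lam_den1 hq sigma N = \prod_(m < N) (topexp hq sigma m - topexp hq sigma N).
Proof.
rewrite -pochv_stepline /Lam_den1; congr (pochv (_ + _) _).
by apply/matrixP => i j; rewrite !mxE.
Qed.

Lemma prod_sub_natr n : \prod_(s < n) (s%:R - n%:R) = (- 1) ^+ n * n`!%:R :> R.
Proof.
have -> : n`! = (\prod_(s < n) (n - s))%N.
  elim: n => [|n IH]; first by rewrite big_ord0.
  by rewrite big_ord_recl/= subn0 factS IH.
rewrite natr_prod -[X in (- 1) ^+ X]card_ord -prodrN; apply: eq_bigr => s _.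
by rewrite natrB 1?ltnW// opprB.
Qed.

Lemma stepline_modord d (hd : (0 < d)%N) N :
  stepline d N.+1 ord0 (modord hd N) = (N %/ d).+1.
Proof. by rewrite (steplineS hd) eqxx addn1 steplineE ltnn addn0. Qed.

Lemma Lam_den2E p (hp : (0 < p)%N) (rho : 'rV[R]_p) N :
  \prod_(m < N) (topexp hp rho m - topexp hp rho N) =
  (- 1) ^+ (N %/ p) * (N %/ p)`!%:R * Lam_den2 rho N (modord hp N).
Proof.
transitivity (\prod_(m < N) (rho ord0 (modord hp m) + (m %/ p)%:R - topexp hp rho N)).
  by apply: eq_bigr => m _; rewrite [topexp hp rho m]topexpE.
rewrite -(stepline_prod hp (fun i s => rho ord0 i + s%:R - topexp hp rho N)).
rewrite (bigD1_ord (modord hp N))//=; congr (_ * _).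
  rewrite steplineE ltnn addn0 -prod_sub_natr; apply: eq_bigr => s _.
  rewrite topexpE; ring.
rewrite /Lam_den2 /pochv /poch; apply: eq_bigr => i _.
have di : col' (modord hp N) (stepline p N.+1) ord0 i =
    stepline p N ord0 (lift (modord hp N) i).
  by rewrite mxE (steplineS hp) eq_sym (negbTE (neq_lift _ _)) addn0.
rewrite di stepline_modord; apply: eq_bigr => -[s /= _] _.
rewrite !mxE topexpE -natr1; ring.
Qed.

Lemma LamE p q (hp : (0 < p)%N) (hq : (0 < q)%N)
    (rho : 'rV[R]_p) (sigma : 'rV[R]_q) N :
  let x := topexp hq sigma in let y m := topexp hp rho m + 1 in
  x N + y N != 0 ->
  Lam hq rho sigma N (modord hp N) = (cauchy_pivot x y N)^-1.
Proof.
move=> x y xy; rewrite /Lam.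
rewrite stepline_modord /= (pochv_stepline hp).
rewrite [const_mx _ + sigma]addrC (pochv_stepline hq) Lam_den1E.
rewrite /cauchy_pivot /cauchy_upper /cauchy_basis.
have -> : \prod_(m < N) (y N - y m) =
    (-1) ^+ N * ((- 1) ^+ (N %/ p) * (N %/ p)`!%:R * Lam_den2 rho N (modord hp N)).
  rewrite -Lam_den2E -[X in (-1) ^+ X]card_ord -prodrN; apply: eq_bigr => m _.
  by rewrite /y; ring.
have -> : \prod_(m < N) (x N - x m) = (-1) ^+ N * \prod_(m < N) (x m - x N).
  by rewrite -[X in (-1) ^+ X]card_ord -prodrN; apply: eq_bigr => m _; ring.
have -> : \prod_(m < N.+1) (y N + x m) =
    (x N + y N) *
      \prod_(m < N) (x m + (rho ord0 (modord hp N) + (N %/ p).+1%:R)).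
  rewrite big_ord_recr/= mulrC [y N + _]addrC; congr (_ * _); apply: eq_bigr => m _.
  by rewrite /y topexpE -natr1; ring.
have -> : \prod_(m < N.+1) (x N + y m) = \prod_(m < N.+1) (topexp hp rho m + (x N + 1)).
  by apply: eq_bigr => m _; rewrite /y; ring.
rewrite !invfM !invrK -!exprVn !invrN1.
have ee : (- 1) ^+ N * (- 1) ^+ N = 1 :> R by rewrite -expr2 sqrr_sign.
rewrite -[LHS]mulr1 -[X in _ * X](divff xy) -[LHS]mulr1 -[X in _ * X]ee.
by rewrite /x; ring.
Qed.

End LamCauchy.

(** * The moments of x^e on (0, 1) *)

Section PowerIntegral.
Import numFieldNormedType.Exports.
Local Open Scope classical_set_scope.
Variable R : realType.
Local Notation mu := (@lebesgue_measure R).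

Lemma integral_powR_cc (a e : R) : 0 < a < 1 -> -1 < e ->
  (\int[mu]_(x in `[a, 1%R]) (x `^ e)%R%:E = ((1 - a `^ (e + 1)) / (e + 1))%R%:E)%E.
Proof.
move=> /andP[a0 a1] e1; have e10 : e + 1 != 0 by rewrite gt_eqF//; lra.
pose F (x : R) := (e + 1)^-1 * x `^ (e + 1).
have dF (x : R) : 0 < x -> is_derive x 1 F (x `^ e).
  move=> x0; have := is_derive1_powR (e + 1) x0 => h.
  have := is_deriveZ (e + 1)^-1 h.
  by rewrite addrK /GRing.scale/= mulKf.
have cF (x : R) : 0 < x -> {for x, continuous F}.
  by move=> x0; apply/differentiable_continuous/derivable1_diffP; case: (dF x x0).
rewrite (@continuous_FTC2 _ (fun x => x `^ e) F)//.
- by rewrite -EFinB /F powR1; congr EFin; field.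
- apply: derivable_within_continuous => x; rewrite in_itv/= => /andP[ax _].
  by case: (is_derive1_powR e (lt_le_trans a0 ax)).
- split.
  + by move=> x; rewrite in_itv/= => /andP[ax _]; case: (dF x (lt_trans a0 ax)).
  + by apply: cvg_at_right_filter; exact: cF.
  + by apply: cvg_at_left_filter; apply: cF.
- move=> x; rewrite in_itv/= => /andP[ax _]; rewrite derive1E.
  by have h := dF x (lt_trans a0 ax); rewrite derive_val.
Qed.

Lemma bigcup_itvcc01 : \bigcup_n `[n.+2%:R^-1, 1%R] = `]0%R, 1%R] :> set R.
Proof.
apply/seteqP; split=> [x [n _]|x] /=; rewrite !in_itv/=.
  by move=> /andP[nx ->]; rewrite andbT (lt_le_trans _ nx)// invr_gt0.
move=> /andP[x0 x1]; exists (Num.bound x^-1) => //=; rewrite in_itv/= x1 andbT.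
rewrite invf_ple ?posrE// ltW// (lt_le_trans (archi_boundP _))//.
  by rewrite invr_ge0 ltW.
by rewrite ler_nat -addn2 leq_addr.
Qed.

Lemma Rintegral_powR_oo (e : R) : -1 < e ->
  \int[mu]_(x in `]0%R, 1%R[) (x `^ e) = (e + 1)^-1.
Proof.
move=> e1; have mf (A : set R) : measurable_fun A (@powR R ^~ e).
  by apply: measurable_funTS; exact: measurable_powR.
rewrite /Rintegral integral_itv_bndo_bndc; last exact/measurable_EFinP.
rewrite -bigcup_itvcc01.
pose G n : set R := `[n.+2%:R^-1, 1%R].
have /(cvg_lim (@ereal_hausdorff R)) <- :
    (\int[mu]_(x in G n) (x `^ e)%R%:E @[n --> \oo] -->
    \int[mu]_(x in \bigcup_n G n) (x `^ e)%R%:E)%E.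
  apply: ge0_nondecreasing_set_cvg_integral => //.
  - apply/nondecreasing_seqP => n; apply/subsetPset => x /=.
    rewrite /G/= !in_itv/= => /andP[nx ->]; rewrite andbT (le_trans _ nx)//.
    by rewrite lef_pV2 ?posrE// ler_nat.
  - by move=> n; apply: measurable_itv.
  - by move=> n; apply/measurable_EFinP; exact: mf.
  - by move=> n x _; rewrite lee_fin powR_ge0.
suff /(cvg_lim (@ereal_hausdorff R)) -> :
    (\int[mu]_(x in G n) (x `^ e)%R%:E @[n --> \oo] -->
    ((e + 1)^-1)%R%:E)%E by [].
rewrite (_ : (fun _ => _) =
    (fun n => ((1 - n.+2%:R^-1 `^ (e + 1)) / (e + 1))%:E)); last first.
  apply/funext => n; apply: integral_powR_cc => //.
  by rewrite invr_gt0 ltr0n/= invf_lt1// ltr1n.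
apply: cvg_EFin; first exact: nearW.
rewrite -[X in _ --> X]mul1r; apply: cvgMl.
rewrite -[X in _ --> X]subr0; apply: cvgB; first exact: cvg_cst.
have := @powR_cvg0 R (e + 1); rewrite -ltrBlDr sub0r => /(_ e1) /cvg_at_rightP; apply.
split=> [n|]; first by rewrite invr_gt0.
have := @cvg_harmonic R; rewrite -(cvg_shiftS (harmonic : nat -> R)); exact.
Qed.

End PowerIntegral.

(** * The mixed Piñeiro system *)

Section PineiroCauchy.
Variables (R : realType) (p q : nat) (hp : (0 < p)%N) (hq : (0 < q)%N).
Variables (rho : 'rV[R]_p) (sigma : 'rV[R]_q).
Hypothesis hexp : forall (i : 'I_p) (j : 'I_q), -1 < rho ord0 i + sigma ord0 j.

Local Notation x := (topexp hq sigma).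
Local Notation y := (fun m => topexp hp rho m + 1).

Lemma topexp_add_gtN1 i j : -1 < x i + topexp hp rho j.
Proof.
rewrite !topexpE addrACA [sigma _ _ + _]addrC ltr_wpDr//.
Qed.

Lemma pineiro_momentE i j : pineiro_moment hp hq rho sigma i j = (x i + y j)^-1.
Proof.
have := topexp_add_gtN1 i j; rewrite /pineiro_moment !topexpE => h.
rewrite Rintegral_powR_oo; first by congr (_^-1); ring.
by apply: (lt_le_trans h); lra.
Qed.

Lemma pineiro_generic : nonzero_denominators hp hq rho sigma -> cauchy_generic x y.
Proof.
move=> [hL _ _ _]; have {}hL N := hL 0%N N (leq0n p).
split=> [i j|i j ij|i j ij].
- by rewrite gt_eqF//; have := topexp_add_gtN1 i j; lra.
- have [+ _] := hL j; rewrite Lam_den1E => /prodf_neq0 /(_ (Ordinal ij) isT) /=.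
  by rewrite -oppr_eq0 opprB.
- have [_ h2] := hL j.
  have : \prod_(m < j) (topexp hp rho m - topexp hp rho j) != 0.
    rewrite Lam_den2E; apply: mulf_neq0 h2.
    apply: mulf_neq0; first by rewrite signr_eq0.
    by rewrite pnatr_eq0 -lt0n fact_gt0.
  move=> /prodf_neq0 /(_ (Ordinal ij) isT) /=; rewrite -oppr_eq0 opprB.
  by apply: contra_neq => h; rewrite -[RHS]h; ring.
Qed.

Lemma LamL_pivot k N :
  LamL hq rho sigma k N (modord hp N) = (cauchy_pivot x (shiftseq k y) N)^-1.
Proof.
have e : (fun m => topexp hp (cycn k rho) m + 1) = shiftseq k y.
  by apply/funext => m; rewrite topexp_cycn.
rewrite /LamL LamE ?e// topexp_cycn.
by rewrite gt_eqF//; have := topexp_add_gtN1 N (N + k); lra.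
Qed.

Lemma LamR_pivot k N :
  LamR hq rho sigma k N (modord hp N) = (cauchy_pivot (shiftseq k x) y N)^-1.
Proof.
have e : topexp hq (cycn k sigma) = shiftseq k x.
  by apply/funext => m; rewrite topexp_cycn.
rewrite /LamR LamE ?e//.
by rewrite gt_eqF//; have := topexp_add_gtN1 (N + k) N; rewrite /shiftseq; lra.
Qed.

End PineiroCauchy.

Theorem corollary7p5 (R : realType) (p q : nat)
    (hp : (0 < p)%N) (hq : (0 < q)%N)
    (rho : 'rV[R]_p) (sigma : 'rV[R]_q)
    (hexp : forall (i : 'I_p) (j : 'I_q), -1 < rho ord0 i + sigma ord0 j)
    (hnormal : all_normal hp hq rho sigma)
    (hden : nonzero_denominators hp hq rho sigma)
    (L Li U Ui : simatrix R)
    (hGB : gauss_borel (pineiro_moment hp hq rho sigma) L Li U Ui) :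
  exists LP UP : nat -> simatrix R,
    [/\ forall k, (1 <= k <= p)%N ->
          [/\ lower_bidiagonal (LP k),
              forall N, LP k N N = 1
            & forall N, LP k N.+1 N =
                LamL hq rho sigma k N (modord hp N) /
                LamL hq rho sigma k.-1 N.+1 (modord hp N.+1)],
        forall k, (1 <= k <= q)%N ->
          [/\ upper_bidiagonal (UP k),
              forall N, UP k N N.+1 = 1
            & forall N, UP k N N =
                LamR hq rho sigma k.-1 N (modord hp N) /
                LamR hq rho sigma k N (modord hp N)]
      & recurrence_matrix q L Li =
          simul (siprod [seq LP k | k <- iota 1 p])
                (siprod [seq UP k | k <- rev (iota 1 q)])].

Proof.
pose x := topexp hq sigma; pose y m := topexp hp rho m + 1.
exists (fun k => cauchy_lower_factor x (shiftseq k.-1 y)).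
exists (fun k => cauchy_upper_factor (shiftseq k.-1 x) y).
split.
- move=> [//|k] _; split=> [|N|N].
  + exact: cauchy_lower_factor_bidiagonal.
  + by rewrite /cauchy_lower_factor eqxx.
  + rewrite !LamL_pivot// invrK mulrC /cauchy_lower_factor ltn_eqF// eqxx.
    by rewrite shiftseqS.
- move=> [//|k] _; split=> [|N|N].
  + exact: cauchy_upper_factor_bidiagonal.
  + by rewrite /cauchy_upper_factor gtn_eqF// eqxx.
  + by rewrite !LamR_pivot// invrK mulrC /cauchy_upper_factor eqxx shiftseqS.
- apply: cauchy_bidiagonal_factorization hGB.
  + exact: pineiro_generic.
  + exact: pineiro_momentE.
  + exact: topexp_period.
  + by move=> m; rewrite /y topexp_period.
Qed.
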